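(* Let $S$ be a compact set in $\mathbb{E}^d$. Then $$\ker_{\mathrm{s}} S = \bigcap_{x\in \operatorname{bd} S} \operatorname{conv}_{\mathrm{s}}\big(\operatorname{st}_{\mathrm{s}}(x,S)\big),$$ where $\operatorname{bd} S$ is the boundary of $S$ in $\mathbb{E}^d$.
   Context: For $x,y\in\mathbb{E}^d$ the (unit) spindle $[x,y]_{\mathrm{s}}$ is the intersection of all closed unit balls $\mathbf{B}[u,1]$ ($u\in\mathbb{E}^d$) containing both $x$ and $y$ if $|x-y|\le 2$, and $[x,y]_{\mathrm{s}}=\mathbb{E}^d$ if $|x-y|>2$. For $A\subseteq\mathbb{E}^d$ and $p\in A$, the spindle visibility region is $\operatorname{st}_{\mathrm{s}}(p,A)=\{q\in A: [p,q]_{\mathrm{s}}\subseteq A\}$. The spindle kernel is $\ker_{\mathrm{s}} A=\{p\in A: \operatorname{st}_{\mathrm{s}}(p,A)=A\}$. A set $A$ is spindle convex if $A=\ker_{\mathrm{s}}A$ (i.e. $[x,y]_{\mathrm{s}}\subseteq A$ for all $x,y\in A$). The spindle convex hull $\operatorname{conv}_{\mathrm{s}}(X)$ of $X\subseteq\mathbb{E}^d$ is the intersection of all spindle convex sets containing $X$.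
   Formalization: The compact set S is assumed nonempty: for S empty the boundary is empty, so the right-hand intersection is all of E^d while the spindle kernel is empty, and the stated equality fails. *)

(* Defs.v *)
(* Points of E^d are row vectors 'rV[R]_d,
   R : realType, with the Euclidean distance; the topology is the library's
   (product) topology on matrices, which coincides with the Euclidean one. *)
From HB Require Import structures.
From mathcomp Require Import all_boot all_order all_algebra.
From mathcomp Require Import all_classical all_reals all_analysis.
Set Implicit Arguments. Unset Strict Implicit. Unset Printing Implicit Defensive.
Import Order.TTheory GRing.Theory Num.Theory.
Import numFieldNormedType.Exports.
Local Open Scope classical_set_scope.
Local Open Scope ring_scope.

Section Spindle.
Variables (R : realType) (d : nat).
Notation E := 'rV[R]_d.

Definition edist (x y : E) : R := Num.sqrt (\sum_(i < d) (x ord0 i - y ord0 i) ^+ 2).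

Definition unit_ball (u : E) : set E := [set y | edist u y <= 1].

Definition spindle (x y : E) : set E :=
  if edist x y <= 2 then
    \bigcap_(u in [set u | unit_ball u x /\ unit_ball u y]) unit_ball u
  else setT.

Definition st_s (p : E) (A : set E) : set E :=
  [set q | A q /\ spindle p q `<=` A].

Definition ker_s (A : set E) : set E := [set p | A p /\ st_s p A = A].

Definition spindle_convex (A : set E) : Prop := A = ker_s A.

Definition conv_s (X : set E) : set E :=
  \bigcap_(C in [set C | spindle_convex C /\ X `<=` C]) C.

Definition bd (A : set E) : set E := closure A `\` interior A.

End Spindle.

(* Main.v *)
(* Idea. Suppose [p] lies in the intersection while some [z] in the spindle of
   [p] and some [q] in [S] is not in [S]. Slide from [q] to [z] along an arc of
   radius at least 1 through [p]: a weighted last-contact point [x] with [S]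
   is the point of [S] nearest to some outside point, so near [x] the set [S]
   lies beyond a small ball; let [n] be the unit vector pointing from the centre
   of that ball to [x]. A spindle with apex [x] that avoids such a ball stays in
   the unit ball tangent to it at [x], centred at [x + n]; hence that unit ball
   contains the spindle visibility region of [x] and, being spindle convex, its
   spindle hull. The choice of the arc keeps [p] outside this unit ball. If
   some point of [S] is at distance more than 2 from [p], the point of [S]
   farthest from [p] plays the role of [x].
   Spindles with apex [x] and arcs through [p] are handled by inversion, which
   turns the relevant arcs into half-lines. *)
Require Import Defs.
From HB Require Import structures.
From mathcomp Require Import all_boot all_order all_algebra.
From mathcomp Require Import all_classical all_reals all_analysis.
From mathcomp Require Import ring lra.
Import Order.TTheory GRing.Theory Num.Theory.
Import numFieldNormedType.Exports.
Local Open Scope classical_set_scope.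
Local Open Scope ring_scope.

(** * The Euclidean inner product *)

Section DotProduct.
Context {R : realType} {d : nat}.
Implicit Types (u v w : 'rV[R]_d) (k : R).

Definition dot u v : R := \sum_(i < d) u ord0 i * v ord0 i.

Lemma dotC u v : dot u v = dot v u.
Proof. by apply: eq_bigr => i _; rewrite mulrC. Qed.

Lemma dotDl u v w : dot (u + v) w = dot u w + dot v w.
Proof. by rewrite -big_split; apply: eq_bigr => i _; rewrite mxE mulrDl. Qed.

Lemma dotZl k u v : dot (k *: u) v = k * dot u v.
Proof. by rewrite mulr_sumr; apply: eq_bigr => i _; rewrite mxE mulrA. Qed.

Lemma dotNl u v : dot (- u) v = - dot u v.
Proof. by rewrite -scaleN1r dotZl mulN1r. Qed.

Lemma dotDr u v w : dot u (v + w) = dot u v + dot u w.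
Proof. by rewrite !(dotC u) dotDl. Qed.

Lemma dotZr k u v : dot u (k *: v) = k * dot u v.
Proof. by rewrite !(dotC u) dotZl. Qed.

Lemma dotNr u v : dot u (- v) = - dot u v.
Proof. by rewrite !(dotC u) dotNl. Qed.

Definition dotE := (dotDl, dotDr, dotNl, dotNr, dotZl, dotZr).

Lemma dot0l u : dot 0 u = 0.
Proof. by rewrite -(scale0r 0) dotZl mul0r. Qed.

Lemma dot_ge0 u : 0 <= dot u u.
Proof. by apply: sumr_ge0 => i _; rewrite -expr2 sqr_ge0. Qed.

Lemma dot_eq0 u : (dot u u == 0) = (u == 0).
Proof.
apply/eqP/eqP => [u0|->]; last exact: dot0l.
apply/rowP => i; rewrite mxE; apply/eqP; rewrite -[_ == 0]orbb -mulf_eq0.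
apply/eqP; apply: (psumr_eq0P _ u0) => // j _.
by rewrite -expr2 sqr_ge0.
Qed.

Lemma dot_gt0 u : (0 < dot u u) = (u != 0).
Proof. by rewrite lt0r dot_ge0 andbT dot_eq0. Qed.

Lemma dot_CS u v : dot u v ^+ 2 <= dot u u * dot v v.
Proof.
have [->|v0] := eqVneq v 0; first by rewrite dotC !dot0l expr0n mulr0.
have := dot_ge0 (dot v v *: u - dot u v *: v).
rewrite !dotE (dotC v u) => h.
move: v0; rewrite -dot_gt0 => v0.
rewrite -subr_ge0 -(pmulr_rge0 _ v0).
by apply: le_trans h _; rewrite le_eqVlt; apply/orP; left; apply/eqP; ring.
Qed.

Lemma unit_scale u : u != 0 -> exists2 k, 0 < k & k ^+ 2 * dot u u = 1.
Proof.
rewrite -dot_gt0 => u0; exists (Num.sqrt (dot u u))^-1.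
  by rewrite invr_gt0 sqrtr_gt0.
by rewrite exprVn sqr_sqrtr ?ltW // mulVf // gt_eqF.
Qed.

End DotProduct.

(** * Spindles based at an endpoint, and inversion *)

Section Spindles.
Context {R : realType} {d : nat}.
Implicit Types (x y z u v w b n p q : 'rV[R]_d) (S : set 'rV[R]_d).

Lemma edist_le x y (r : R) : 0 <= r ->
  (Defs.edist x y <= r) = (dot (y - x) (y - x) <= r ^+ 2).
Proof.
move=> r0; rewrite /Defs.edist.
have -> : \sum_(i < d) (x ord0 i - y ord0 i) ^+ 2 = dot (y - x) (y - x).
  by apply: eq_bigr => i _; rewrite !mxE; ring.
by rewrite -[X in _ <= X = _](ger0_norm r0) -sqrtr_sqr ler_sqrt ?sqr_ge0.
Qed.

Lemma unit_ballE u y : unit_ball u y <-> dot (y - u) (y - u) <= 1.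
Proof. by rewrite /unit_ball /= edist_le // expr1n. Qed.

Lemma edist_le2 x y :
  (Defs.edist x y <= 2) = (dot (y - x) (y - x) <= 4).
Proof. by rewrite edist_le //; congr (_ <= _); ring. Qed.

Lemma spindleT x y : 4 < dot (y - x) (y - x) -> spindle x y = setT.
Proof. by move=> h; rewrite /spindle edist_le2 leNgt h. Qed.

Lemma spindleP x y z : dot (y - x) (y - x) <= 4 ->
  spindle x y z <->
  forall g, dot g g <= 1 -> dot (y - x - g) (y - x - g) <= 1 ->
    dot (z - x - g) (z - x - g) <= 1.
Proof.
move=> h; rewrite /spindle edist_le2 h; split.
  move=> sz g g1 yg.
  have := sz (x + g); rewrite /= !unit_ballE opprD !addrA; apply; split=> //.
  by rewrite subrr sub0r !dotE opprK.
move=> sz u [/unit_ballE ux /unit_ballE uy].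
have e a : a - x - (u - x) = a - u by rewrite opprB addrA subrK.
apply/unit_ballE; rewrite -e; apply: sz; rewrite ?e //.
by rewrite -opprB dotNl dotNr opprK.
Qed.

(* Inversion in the unit sphere about [x] turns the spindle of [x] and [x + h]
   into the shadow that [h / |h|^2] casts when lit from the ball of radius 1/2:
   the unit balls with [x] on the boundary become the half-spaces tangent to
   that ball. *)
Lemma spindle_shadow x h b (s : R) :
  let w := (1 + s) *: ((dot h h)^-1 *: h) - s *: b in
  h != 0 -> dot b b <= 4^-1 -> 0 <= s -> w != 0 ->
  spindle x (x + h) (x + (dot w w)^-1 *: w).
Proof.
move=> w h0 b1 s0 w0.
have [H4|H4] := leP (dot h h) 4; last by rewrite spindleT // addrC addKr.
have e a : x + a - x = a by rewrite addrC addKr.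
rewrite spindleP e // => g g1 hg; rewrite e.
move: h0 w0; rewrite -!dot_gt0 => h0 w0.
(* Let [phi c = (1 - |g|^2) |c|^2 - 1 + 2 <c, g>]. For nonzero [c], [c / |c|^2] is in the unit ball
   about [g] exactly when [phi c >= 0]. As [phi] is convex, nonpositive at [b] and nonnegative at
   the inverse of [h], it is nonnegative farther along that ray, at [w]. *)
have Qv : 1 - 2 * ((dot h h)^-1 * dot h g) <= (1 - dot g g) * (dot h h)^-1.
  rewrite -subr_ge0.
  have -> : (1 - dot g g) * (dot h h)^-1 - (1 - 2 * ((dot h h)^-1 * dot h g))
      = (dot h h)^-1 * (1 - dot g g - dot h h + 2 * dot h g).
    by field; rewrite gt_eqF.
  apply: mulr_ge0; first by rewrite invr_ge0 ltW.
  by move: hg; rewrite !dotE (dotC g h); lra.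
have Qb : (1 - dot g g) * dot b b <= 1 - 2 * dot b g.
  have := dot_CS b g; have := dot_ge0 g; have := dot_ge0 b.
  move: (dot b b) (dot b g) (dot g g) b1 g1 => bb bg gg bb4 gg1 bb0 gg0 CS.
  have bg2 : bg <= 2^-1 by nra.
  have : 0 <= (2^-1 - bg) * (3 / 2 - bg) by apply: mulr_ge0; lra.
  nra.
have Qw : 1 - 2 * dot w g <= (1 - dot g g) * dot w w.
  have : 1 - 2 * dot ((dot h h)^-1 *: h) g
      <= (1 - dot g g) * dot ((dot h h)^-1 *: h) ((dot h h)^-1 *: h).
    by rewrite !dotE mulVf ?mulr1 // gt_eqF.
  rewrite /w; move: ((dot h h)^-1 *: h) => v Qv'.
  have N := dot_ge0 (v - b); move: N; rewrite !dotE (dotC b v).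
  move: (dot b b) (dot b g) (dot g g) g1
    (dot v v) (dot v g) (dot v b) Qv' Qb.
  move=> bb bg gg g1 vv vg vb Qv' Qb N.
  have h1 : 0 <= (1 + s) * ((1 - gg) * vv - (1 - 2 * vg)) by apply: mulr_ge0; lra.
  have h2 : 0 <= s * (1 - 2 * bg - (1 - gg) * bb) by apply: mulr_ge0; lra.
  have h3 : 0 <= (1 - gg) * (s * (1 + s)) * (vv - vb + (- vb - - bb)).
    by apply: mulr_ge0; [apply: mulr_ge0; [lra|apply: mulr_ge0; lra]|lra].
  lra.
move: w w0 Qw => /= w w0 Qw.
rewrite !dotE (dotC g w) -(ler_pM2l w0).
have -> : dot w w * ((dot w w)^-1 * ((dot w w)^-1 * dot w w) - (dot w w)^-1 * dot w g +
 (- ((dot w w)^-1 * dot w g) - - dot g g)) = 1 - 2 * dot w g + dot w w * dot g g.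
  by field; rewrite gt_eqF.
lra.
Qed.

(** * Unit balls and proximal normals *)

Lemma conv_s_sub_unit_ball S u :
  S `<=` unit_ball u -> conv_s S `<=` unit_ball u.
Proof.
move=> Su y; apply; split=> //.
suff bs x q : unit_ball u x -> unit_ball u q -> spindle x q `<=` unit_ball u.
  apply/seteqP; split=> [x ux|x []//]; split=> //.
  by apply/seteqP; split=> [q []//|q uq]; split=> //; exact: bs.
(* Points of a unit ball are at distance at most 2, so the ball is one of those intersected in the
   spindle. *)
move=> ux uq z; rewrite /spindle edist_le2 ifT; first by apply.
move/unit_ballE: ux => ux; move/unit_ballE: uq => uq.
have -> : q - x = (q - u) - (x - u) by rewrite opprB addrA subrK.
move: (x - u) (q - u) ux uq => a c aa cc.
have := dot_ge0 (a + c); rewrite !dotE (dotC c a); lra.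
Qed.

(** For a unit vector [n] and [K > 0], [S] misses the open ball of radius [1 / (2 K)] touching [x]
    from the side of [- n]. For [K < 0], [S] lies in the closed ball of radius [1 / (2 |K|)]
    touching [x] from the side of [n]. *)
Definition proximal S x n (K : R) : Prop :=
  forall a, S a -> - K * dot (a - x) (a - x) <= dot (a - x) n.

(* If [y] is outside, the shadow of [y] lit from [n / 2] is a half-line along
   which the inner product with [n] tends to minus infinity; inverted back, this
   is a curve in the spindle leaving [x] on the side excluded by the proximal
   inequality. *)
Lemma visible_sub_unit_ball S x n (K : R) : dot n n = 1 ->
  proximal S x n K ->
  st_s x S `<=` unit_ball (x + n).
Proof.
move=> n1 prox y [Sy xy]; apply/unit_ballE.
have [h yE] : exists h, y = x + h by exists (y - x); rewrite addrC subrK.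
have e a : x + a - x = a by rewrite addrC addKr.
rewrite opprD addrA yE e.
have [->|h0] := eqVneq h 0; first by rewrite sub0r dotNl dotNr opprK n1.
rewrite leNgt; apply/negP => far.
have hh : 0 < dot h h by rewrite dot_gt0.
pose m := (dot h h)^-1 * dot h n.
have m2 : 0 < 2^-1 - m.
  have -> : 2^-1 - m = (dot h h)^-1 * (2^-1 * dot h h - dot h n).
    by rewrite /m; field; rewrite gt_eqF.
  apply: mulr_gt0; first by rewrite invr_gt0.
  by move: far; rewrite !dotE (dotC n h) n1; lra.
(* With [m < 1/2] from [far], this choice gives [<w, n> = m - |K| - 1]. *)
pose s := (`|K| + 1) / (2^-1 - m).
have s0 : 0 <= s by apply: divr_ge0; [rewrite addr_ge0|exact: ltW].
pose w := (1 + s) *: ((dot h h)^-1 *: h) - s *: (2^-1 *: n).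
have wn : dot w n < - `|K|.
  rewrite /w !dotE n1 -/m.
  have : s * (2^-1 - m) = `|K| + 1 by rewrite divfK // gt_eqF.
  lra.
have w0 : w != 0.
  apply/eqP => w0; move: wn; rewrite w0 dot0l.
  by have := normr_ge0 K; lra.
have b1 : dot (2^-1 *: n) (2^-1 *: n) <= 4^-1 by rewrite !dotE n1; lra.
have := spindle_shadow x h _ s h0 b1 s0 w0; rewrite -yE -/w => /xy/prox.
rewrite e; move: w w0 wn => /= w w0 wn.
rewrite -dot_gt0 in w0.
rewrite !dotE mulVf ?gt_eqF// mulr1 mulrC ler_pM2l ?invr_gt0//.
by have := ler_norm K; lra.
Qed.

(** If [x - t *: n] were in [S] for all small [t > 0], the proximal inequality would give
    [1 <= K t]. *)
Lemma proximal_boundary S x n (K : R) : S x -> dot n n = 1 ->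
  proximal S x n K ->
  bd S x.
Proof.
move=> Sx n1 prox; split; first exact: subset_closure.
rewrite /interior /= => Sx'.
have cn : (fun t : R => x - t *: n) @ 0^'+ --> x.
  rewrite -[X in _ --> X]subr0 -[X in _ - X](scale0r n).
  apply: cvg_at_right_filter; apply: cvgB; first exact: cvg_cst.
  by apply: cvgZr_tmp; exact: cvg_id.
have t0 : 0 < (`|K| + 1)^-1 :> R by rewrite invr_gt0 ltr_wpDl.
near (0 : R)^'+ => t.
have tp : 0 < t by near: t; exact: nbhs_right_gt.
have : t < (`|K| + 1)^-1 by near: t; exact: nbhs_right_lt.
rewrite -(ltr_pM2l (_ : 0 < `|K| + 1)) ?ltr_wpDl// mulfV ?gt_eqF ?ltr_wpDl// => tK.
have /prox : S (x - t *: n) by near: t; exact: cn.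
have -> : x - t *: n - x = - (t *: n) by rewrite addrC addKr.
rewrite !dotE n1 !mulr1 opprK mulNr lerN2 mulrA.
rewrite -[X in X <= _]mul1r ler_pM2r //.
by have := ler_norm K; nra.
Unshelve. all: by end_near.
Qed.

(** Reduces the hard inclusion to finding a proximal normal whose unit ball misses [p]. *)
Lemma proximal_excludes S p x n (K : R) : S x -> dot n n = 1 ->
  proximal S x n K ->
  1 < dot (p - x - n) (p - x - n) ->
  ~ (\bigcap_(y in bd S) conv_s (st_s y S)) p.
Proof.
move=> Sx n1 prox far /(_ x (proximal_boundary _ _ _ _ Sx n1 prox)).
move=> /(conv_s_sub_unit_ball _ _ (visible_sub_unit_ball _ _ _ _ n1 prox)).
by move/unit_ballE; rewrite opprD addrA leNgt far.
Qed.

(* For [0 < |k|] this says that the angle at [k] in the triangle [0, h, k] is at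
   least a right angle and that its circumradius is at least 1. *)
Lemma spindle_angle (h k : 'rV[R]_d) : dot h h <= 4 ->
  (forall g, dot g g <= 1 -> dot (h - g) (h - g) <= 1 ->
    dot (k - g) (k - g) <= 1) ->
  dot k k <= dot k h /\
  4 * (dot k k * dot h h - dot k h ^+ 2)
    <= dot k k * dot (k - h) (k - h) * dot h h.
Proof.
move=> h4 hk.
have := dot_CS k h; rewrite -subr_ge0 le_eqVlt => /predU1P[D0|D0].
  split; last first.
    rewrite -D0 mulr0; apply: mulr_ge0; last exact: dot_ge0.
    by apply: mulr_ge0; exact: dot_ge0.
  rewrite leNgt; apply/negP => kkh.
  have k0 : k != 0 by apply/eqP => k0; move: kkh; rewrite k0 !dot0l ltxx.
  have [c c0 ck] := unit_scale _ k0.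
  have kk0 : 0 < dot k k by rewrite dot_gt0.
  have [r rkk] : exists r, dot k h = r * dot k k.
    by exists (dot k h / dot k k); rewrite divfK // gt_eqF.
  have hE : h = r *: k.
    apply/eqP; rewrite -subr_eq0 -dot_eq0 -(mulrI_eq0 _ (mulfI (lt0r_neq0 kk0))).
    by apply/eqP; rewrite !dotE (dotC h k) D0 rkk; ring.
  have r1 : r < 1 by rewrite -(ltr_pM2r kk0) -rkk mul1r.
  have r2 : r ^+ 2 <= (2 * c) ^+ 2.
    rewrite -(ler_pM2r kk0) exprMn -[leRHS]mulrA ck.
    by move: h4; rewrite hE !dotE; lra.
  have c1 a : - c <= a -> a <= c -> dot (a *: k) (a *: k) <= 1.
    move=> ca ac; rewrite !dotE -ck mulrA ler_pM2r//.
    nra.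
  have c2 a : c < a -> 1 < dot (a *: k) (a *: k).
    move=> ca; rewrite !dotE -ck mulrA ltr_pM2r//.
    nra.
  (* The unit ball about [- c *: k], respectively [(r - c) *: k], contains [0] and [h = r *: k] but
     not [k]. *)
  have [r0|r0] := leP r 0.
    have : dot (k - (- c) *: k) (k - (- c) *: k) <= 1.
      apply: hk; first by apply: c1; lra.
      by rewrite hE -scalerBl; apply: c1; nra.
    rewrite -{1 3}(scale1r k) -scalerBl leNgt => /negP; apply; apply: c2; lra.
  have : dot (k - (r - c) *: k) (k - (r - c) *: k) <= 1.
    apply: hk; first by apply: c1; nra.
    by rewrite hE -scalerBl; apply: c1; nra.
  rewrite -{1 3}(scale1r k) -scalerBl leNgt => /negP; apply; apply: c2; lra.
have hh0 : 0 < dot h h.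
  rewrite dot_gt0; apply/eqP => h0.
  by move: D0; rewrite h0 (dotC k) !dot0l mulr0 expr0n subr0 ltxx.
pose r := k - (dot k h / dot h h) *: h.
have hr : dot h r = 0.
  by rewrite /r !dotE (dotC h k); field; rewrite gt_eqF.
have rr : dot r r = (dot k k * dot h h - dot k h ^+ 2) / dot h h.
  by rewrite /r !dotE (dotC h k); field; rewrite gt_eqF.
have kr : dot k r = dot r r.
  by rewrite rr /r !dotE; field; rewrite gt_eqF.
have r0 : r != 0 by rewrite -dot_gt0 rr divr_gt0.
clearbody r; have [c c0 cr] := unit_scale _ r0.
(* The test ball is centred at [h / 2 - e r / |r|], shifted away from [k] until [0] and [h] are on
   its boundary. Squaring [key] gives the circumradius bound. *)
pose e := Num.sqrt (1 - dot h h / 4).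
have e0 : 0 <= e := sqrtr_ge0 _.
have ee : e ^+ 2 = 1 - dot h h / 4 by rewrite sqr_sqrtr //; lra.
have key : dot k k - dot k h <= - (2 * (e * c * dot r r)).
  have ecr : e * (c * (e * (c * dot r r))) = 1 - dot h h / 4.
    by rewrite -ee -[e ^+ 2]mulr1 -cr; ring.
  have : dot (k - (2^-1 *: h - e *: (c *: r))) (k - (2^-1 *: h - e *: (c *: r)))
      <= 1.
    by apply: hk; rewrite !dotE (dotC r h) hr ecr; lra.
  rewrite !dotE (dotC r h) (dotC r k) (dotC h k) hr kr.
  lra.
have pos : 0 <= e * c * dot r r.
  by apply: mulr_ge0; [apply: mulr_ge0 => //; exact: ltW|exact: dot_ge0].
split; first lra.
have sq : (4 - dot h h) * (dot k k * dot h h - dot k h ^+ 2)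
    <= dot h h * (dot k k - dot k h) ^+ 2.
  have -> : (4 - dot h h) * (dot k k * dot h h - dot k h ^+ 2)
      = dot h h * (2 * (e * c * dot r r)) ^+ 2.
    have -> : (2 * (e * c * dot r r)) ^+ 2
      = 4 * e ^+ 2 * (c ^+ 2 * dot r r) * dot r r by ring.
    by rewrite cr ee rr; field; rewrite gt_eqF.
  rewrite ler_pM2l //; nra.
by rewrite !dotE (dotC h k); nra.
Qed.

(** * Extremal contact points *)

Lemma continuous_dot {T : topologicalType} (f g : T -> 'rV[R]_d) :
  continuous f -> continuous g -> continuous (fun t => dot (f t) (g t)).
Proof.
move=> cf cg t; rewrite /dot; apply: cvg_big => [|i _].
  exact: add_continuous.
have coord (F : T -> 'rV[R]_d) : continuous F ->
    (F x ord0 i) @[x --> t] --> F t ord0 i.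
  by move=> cF; exact: (cvg_comp _ _ (cF t) (@coord_continuous R 1 d ord0 i (F t))).
by apply: cvgM; exact: coord.
Qed.

Lemma continuous_subr p : continuous (fun x : 'rV[R]_d => x - p).
Proof. by move=> x; exact: (cvgB (@cvg_id _ (nbhs x)) (cvg_cst p)). Qed.

Lemma ge0_of_affine_right (A C r : R) : 0 < r ->
  (forall e, 0 < e -> e <= r -> 0 <= A + e * C) -> 0 <= A.
Proof.
move=> r0 AC; rewrite leNgt; apply/negP => A0.
have C0 : 0 < `|C| + 1 by rewrite ltr_wpDl.
pose e := Num.min r (- A / (2 * (`|C| + 1))).
have e0 : 0 < e by rewrite lt_min r0 divr_gt0 ?oppr_gt0// mulr_gt0.
have er : e <= r by rewrite ge_min lexx.
have : e * (2 * (`|C| + 1)) <= - A.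
  by rewrite -ler_pdivlMr ?mulr_gt0// ge_min lexx orbT.
by have := AC e e0 er; have := ler_norm C; nra.
Qed.

(** [S] lies in the ball about [p] through its farthest point [x], so the normal towards [p] has a
    negative [K]. As [|x - p| > 2], the unit ball touching [x] from that side does not reach [p]. *)
Lemma farthest_proximal_normal S p q : compact S -> S q ->
  4 < dot (q - p) (q - p) ->
  exists x n (K : R), [/\ S x, dot n n = 1, proximal S x n K &
    1 < dot (p - x - n) (p - x - n)].
Proof.
move=> cS Sq far.
have cont : continuous (fun x : 'rV[R]_d => dot (x - p) (x - p)).
  by apply: continuous_dot; exact: continuous_subr.
have [x /[!inE] Sx max] := @compact_EVT_max _ _ _ S (ex_intro _ _ Sq) cS
  (continuous_subspaceT cont).
have X4 : 4 < dot (x - p) (x - p) by apply: lt_le_trans far (max _ _); rewrite inE.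
have [u xE] : exists u, x = p + u by exists (x - p); rewrite addrC subrK.
have e v : p + v - p = v by rewrite addrC addKr.
rewrite xE e in X4.
have u0 : u != 0 by rewrite -dot_gt0; lra.
have [c c0 cu] := unit_scale _ u0.
exists x, (- (c *: u)), (- (c / 2)); split=> //.
- by rewrite !dotE -cu; ring.
- move=> a Sa; have := max a; rewrite inE => /(_ Sa).
  have -> : a - p = (a - x) + u by rewrite xE opprD !addrA subrK.
  rewrite [in x - p]xE e; move: (a - x) => w; rewrite !dotE (dotC u w); nra.
have -> : p - x - - (c *: u) = c *: u - u.
  by rewrite opprK xE opprD addrA subrr sub0r addrC.
have -> : dot (c *: u - u) (c *: u - u)
    = c ^+ 2 * dot u u + dot u u * (1 - 2 * c) by rewrite !dotE; ring.
have c4 : c ^+ 2 * 4 < 1 by rewrite -[ltRHS]cu ltr_pM2l ?exprn_gt0.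
have c2 : c < 2^-1 by nra.
by rewrite cu ltrDl mulr_gt0 //; lra.
Qed.

(* Along the arc [p + c / |c|^2], [c = b + t D], the quantity minimized is
   [|c|^2] times the squared distance of [a] to the arc point, minus
   [kappa (t^2 - l^2)]. *)
Lemma arc_proximal_normal S p q b (D : 'rV[R]_d) (l del : R) :
  compact S -> S q -> (forall x, S x -> dot (x - p) (x - p) <= 4) ->
  0 < l -> dot b D = 0 -> dot b b <= 4^-1 ->
  let c t := b + t *: D in
  let m x t := 1 - 2 * dot (x - p) (c t) + dot (c t) (c t) * dot (x - p) (x - p) in
  m q l = 0 -> 0 < del -> (forall x, S x -> del <= m x (l + 1)) ->
  exists x n (K : R), [/\ S x, dot n n = 1, proximal S x n K &
    1 < dot (p - x - n) (p - x - n)].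
Proof.
move=> cS Sq S4 l0 bD b4 c m mq del0 mdel.
(* The weight [kap * (t ^+ 2 - l ^+ 2)] is [del / 2] at [t = l + 1], so [G] is positive there and
   its minimum lies elsewhere. *)
pose kap := del / (2 * (2 * l + 1)).
have kap0 : 0 < kap by rewrite divr_gt0 // mulr_gt0 //; lra.
have kapE : kap * (2 * l + 1) = del / 2.
  by rewrite /kap; field; lra.
pose G (xt : 'rV[R]_d * R) := m xt.1 xt.2 - kap * (xt.2 ^+ 2 - l ^+ 2).
have cG : continuous G.
  have c1 : continuous (fun xt : 'rV[R]_d * R => xt.1 - p).
    by move=> xt; apply: cvgB; [exact: cvg_fst|exact: cvg_cst].
  have c2 : continuous (fun xt : 'rV[R]_d * R => c xt.2).
    move=> xt; apply: cvgD; first exact: cvg_cst.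
    by apply: cvgZr_tmp; exact: cvg_snd.
  have sq : continuous (fun xt : 'rV[R]_d * R => xt.2 ^+ 2).
    by move=> xt; exact: (cvgM (@cvg_snd _ _ _ _ (nbhs_filter _))
      (@cvg_snd _ _ _ _ (nbhs_filter _))).
  move=> xt; apply: cvgB; last first.
    apply: cvgM; first exact: cvg_cst.
    by apply: cvgB; [exact: sq|exact: cvg_cst].
  have c12 := continuous_dot _ _ c1 c2.
  have c22 := continuous_dot _ _ c2 c2.
  have c11 := continuous_dot _ _ c1 c1.
  apply: cvgD; last exact: (cvgM (c22 xt) (c11 xt)).
  apply: cvgB; first exact: cvg_cst.
  exact: (cvgM (cvg_cst _) (c12 xt)).
have l1 : `[l, l + 1]%classic l by rewrite /= in_itv /= lexx; lra.
have [[x t] /[!inE] -[/= Sx]] := @compact_EVT_min _ _ G (S `*` `[l, l + 1]%classic)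
  (ex_intro _ (q, l) (conj Sq l1)) (compact_setX cS (@segment_compact _ _ _))
  (continuous_subspaceT cG).
rewrite in_itv /= => /andP[lt tl] min.
have G0 : G (x, t) <= 0.
  have := min (q, l); rewrite inE => /(_ (conj Sq l1)).
  by rewrite {2}/G /= mq; lra.
have t1 : t < l + 1.
  rewrite lt_neqAle tl andbT; apply/eqP => tE.
  move: G0; rewrite /G /= tE; have := mdel x Sx.
  by rewrite -/(m _ _); move: (m x (l + 1)) => m1; nra.
have mint a : S a -> m x t <= m a t.
  move=> Sa; have := min (a, t); rewrite inE => /(_ (conj Sa _)).
  by rewrite /G /= in_itv /= lt tl => /(_ isT); lra.
have [y xE] : exists y, x = p + y by exists (x - p); rewrite addrC subrK.
have xp v : p + v - p = v by rewrite addrC addKr.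
have y4 : dot y y <= 4 by have := S4 x Sx; rewrite xE xp.
(* The minimum may sit at [t = l], so [t] is only increased: the right derivative of [G] is
   nonnegative. *)
have stat : dot y D <= t * (dot y y * dot D D - kap).
  rewrite -subr_ge0 -(pmulr_rge0 _ (_ : 0 < 2)) //.
  apply: (@ge0_of_affine_right _ (dot y y * dot D D - kap) (l + 1 - t)); first lra.
  move=> e e0 el; rewrite -(pmulr_rge0 _ e0).
  have := min (x, t + e); rewrite inE => /(_ (conj Sx _)).
  rewrite /G /m /c /= in_itv /= xE xp => /(_ _).
  have -> : (l <= t + e <= l + 1) by apply/andP; split; lra.
  move=> /(_ isT); rewrite -subr_ge0 !dotE (dotC D b) bD; lra.
have m0 : 0 <= m x t.
  rewrite /m xE xp; have := dot_CS y (c t).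
  by have := sqr_ge0 (1 - dot y (c t)); lra.
have mk : m x t <= kap * (t ^+ 2 - l ^+ 2) by move: G0; rewrite /G /=; lra.
pose C := dot (c t) (c t).
have CE : C = dot b b + t ^+ 2 * dot D D.
  by rewrite /C /c !dotE (dotC D b) bD; ring.
have yb : dot y b <= 1.
  have := le_trans (dot_CS y b) (ler_pM (dot_ge0 y) (dot_ge0 b) y4 b4).
  by rewrite mulfV //; nra.
(* [v / C] leads from the arc point at parameter [t] to [x], a point of [S] nearest to it. *)
pose v := C *: y - c t.
(* [stat] and [mk] leave a surplus [kap * l ^+ 2]; the weight in [G] makes this inequality
   strict. *)
have E : 0 < dot y v * (1 - 2 * dot y b) + dot y y * dot v b.
  have -> : dot y v * (1 - 2 * dot y b) + dot y y * dot v b =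
     - m x t * dot y b - t * dot y D + t ^+ 2 * dot D D * dot y y.
    by rewrite /m /v xE xp -/C CE /c !dotE (dotC D b) bD; ring.
  have mb : m x t * dot y b <= m x t by rewrite ler_piMr.
  have t0 : 0 <= t by lra.
  have := ler_wpM2l t0 stat; have : 0 < kap * l ^+ 2 by rewrite mulr_gt0 ?exprn_gt0.
  lra.
have v0 : v != 0.
  by apply/eqP => v0; move: E; rewrite v0 (dotC y) !dot0l mul0r mulr0 addr0 ltxx.
have prox a : S a -> - (C / 2) * dot (a - x) (a - x) <= dot (a - x) v.
  move=> /mint; rewrite /m -/C.
  have -> : a - p = (a - x) + y by rewrite xE opprD !addrA subrK.
  rewrite {1 2 3}xE xp /v; move: (a - x) => w; rewrite !dotE (dotC y w); lra.
clearbody v.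
have [k k0 kv] := unit_scale _ v0.
exists x, (k *: v), (k * (C / 2)); split=> //.
- by rewrite !dotE mulrA -expr2.
- move=> a /prox; move: (a - x) => w pw.
  by rewrite dotZr -mulrN -mulrA ler_pM2l.
have -> : p - x - k *: v = - (y + k *: v).
  by rewrite xE opprD addrA subrr sub0r opprD.
rewrite dotNl dotNr opprK.
have -> : dot (y + k *: v) (y + k *: v)
   = dot y y + 2 * (k * dot y v) + k ^+ 2 * dot v v.
  by rewrite !dotE (dotC v y); ring.
(* Up to the factor [|y|^2], the vector is the reflection of [k *: v] in the hyperplane orthogonal
   to [y]. With [|b| <= 1/2] this yields [B], and [B] with [E] gives [2 k <y, v> > - |y|^2]. *)
have := dot_CS (k *: (dot y y *: v - (2 * dot y v) *: y)) b.
have -> : dot (k *: (dot y y *: v - (2 * dot y v) *: y))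
  (k *: (dot y y *: v - (2 * dot y v) *: y)) = dot y y ^+ 2 * (k ^+ 2 * dot v v).
  by rewrite !dotE (dotC v y); ring.
rewrite kv mulr1 !dotE => CS.
have B : k * (dot y y * dot v b - 2 * dot y v * dot y b) <= dot y y / 2.
  move: CS; have -> : k * (dot y y * dot v b + - (2 * dot y v * dot y b))
    = k * (dot y y * dot v b - 2 * dot y v * dot y b) by [].
  move: (k * _) (dot_ge0 y) (dot_ge0 b) => f X0 b0 CS.
  have : f ^+ 2 <= (dot y y / 2) ^+ 2 by nra.
  by nra.
have : 0 < k * (dot y v * (1 - 2 * dot y b) + dot y y * dot v b) by rewrite mulr_gt0.
lra.
Qed.

(** * From a missing spindle point to an arc *)

Lemma compact_dist_gt0 S z : compact S -> S !=set0 -> ~ S z ->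
  exists2 del : R, 0 < del & forall x, S x -> del <= dot (x - z) (x - z).
Proof.
move=> cS S0 Sz.
have cont : continuous (fun x : 'rV[R]_d => dot (x - z) (x - z)).
  by apply: continuous_dot; exact: continuous_subr.
have [x /[!inE] Sx min] := @compact_EVT_min _ _ _ S S0 cS
  (continuous_subspaceT cont).
exists (dot (x - z) (x - z)); last by move=> y Sy; apply: min; rewrite inE.
by rewrite dot_gt0 subr_eq0; apply/eqP => xz; apply: Sz; rewrite -xz.
Qed.

Lemma spindleC x y : spindle x y = spindle y x.
Proof.
rewrite /spindle !edist_le2 -(opprB y x) dotNl dotNr opprK; case: ifP => // _.
by apply/seteqP; split=> z sz u [ux uy]; exact: sz.
Qed.

(** A small move towards the midpoint of [p] and [q] stays in the spindle and off the closed set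
    [S]. It makes the angle strictly obtuse, which later gives [l > 0]. *)
Lemma spindle_perturb S p q z : compact S -> dot (q - p) (q - p) <= 4 ->
  spindle p q z -> ~ S z ->
  exists2 z', ~ S z' & spindle p q z' /\
    (p != q -> dot (z' - p) (z' - p) < dot (z' - p) (q - p)).
Proof.
move=> cS pq4 pqz Sz.
have oS : open (~` S).
  by apply: closed_openC; apply: compact_closed => //; exact: norm_hausdorff.
pose f (t : R) := z + t *: (p + 2^-1 *: (q - p) - z).
have cf : f t @[t --> 0^'+] --> z.
  rewrite -[X in _ --> X]addr0 -[X in _ + X](scale0r (p + 2^-1 *: (q - p) - z)).
  apply: cvg_at_right_filter; apply: cvgD; first exact: cvg_cst.
  by apply: cvgZr_tmp; exact: cvg_id.
near (0 : R)^'+ => t.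
have t0 : 0 < t by near: t; exact: nbhs_right_gt.
have t1 : t < 1 by near: t; exact: nbhs_right_lt.
have Sf : ~ S (f t).
  by near: t; exact: (cf _ (open_nbhs_nbhs (conj oS Sz))).
exists (f t) => //.
have fE : f t - p = (1 - t) *: (z - p) + t *: (2^-1 *: (q - p)).
  rewrite /f; apply/rowP => i; rewrite !mxE; ring.
have hk := iffLR (spindleP _ _ _ pq4) pqz.
have [kh _] := spindle_angle _ _ pq4 hk.
split=> [|pq].
  apply/(spindleP _ _ _ pq4) => g g1 hg.
  have := hk g g1 hg; move: hg; rewrite fE; move: (z - p) (q - p) => k h.
  have -> : (1 - t) *: k + t *: (2^-1 *: h) - g =
      (1 - t) *: (k - g) + (t / 2) *: (h - g) - (t / 2) *: g.
    by apply/rowP => i; rewrite !mxE; field.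
  move: (k - g) (h - g) => a e ee aa.
  have := dot_ge0 (a - e); have := dot_ge0 (a + g); have := dot_ge0 (e + g).
  rewrite !dotE (dotC e a) (dotC g a) (dotC g e).
  move: (dot a a) (dot e e) (dot g g) (dot a e) (dot a g) (dot e g) aa ee g1.
  move=> aa ee gg ae ag eg aa1 ee1 gg1 eg0 ag0 ae0.
  have h1 := mulr_ge0 (ltW t0) (ltW t0).
  have h2 : 0 <= (1 - t) * t by apply: mulr_ge0; lra.
  have h3 := mulr_ge0 h1 eg0; have h4 := mulr_ge0 h2 ag0.
  have h5 := mulr_ge0 h2 ae0.
  have h6 : 0 <= (1 - t) * (1 - aa) by apply: mulr_ge0; lra.
  have h7 : 0 <= t * (2 - ee - gg) by apply: mulr_ge0; lra.
  lra.
have : 0 < dot (q - p) (q - p) by rewrite dot_gt0 subr_eq0 eq_sym.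
rewrite fE; move: (z - p) (q - p) kh => k h kh hh.
rewrite !dotE (dotC h k).
have h1 : 0 <= (1 - t) ^+ 2 * (dot k h - dot k k).
  by apply: mulr_ge0; [exact: sqr_ge0|lra].
have h2 : 0 < t * (2 - t) * dot h h by apply: mulr_gt0 => //; apply: mulr_gt0; lra.
lra.
Unshelve. all: by end_near.
Qed.

Lemma spindle_proximal_normal S p q z0 : compact S -> S q ->
  spindle p q z0 -> ~ S z0 ->
  exists x n (K : R), [/\ S x, dot n n = 1, proximal S x n K &
    1 < dot (p - x - n) (p - x - n)].
Proof.
move=> cS Sq pqz0 Sz0.
have [[y [Sy far]]|near4] := pselect (exists y, S y /\ 4 < dot (y - p) (y - p)).
  exact: farthest_proximal_normal cS Sy far.
have S4 x : S x -> dot (x - p) (x - p) <= 4.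
  by move=> Sx; rewrite leNgt; apply/negP => x4; apply: near4; exists x.
have [z Sz [pqz kh]] := spindle_perturb _ _ _ _ cS (S4 q Sq) pqz0 Sz0.
have [kh' ang] := spindle_angle _ _ (S4 q Sq)
  (iffLR (spindleP _ _ _ (S4 q Sq)) pqz).
have pq : p != q.
  apply/eqP => pq; apply: Sz; move: kh'.
  rewrite pq subrr (dotC _ 0) dot0l => zq.
  have /eqP : dot (z - q) (z - q) == 0 by rewrite eq_le dot_ge0 andbT.
  by move/eqP; rewrite dot_eq0 subr_eq0 => /eqP ->.
move: {kh}(kh pq) => kh.
have [del del0 Sdel] := compact_dist_gt0 _ _ cS (ex_intro _ _ Sq) Sz.
have zE a : a - z = (a - p) - (z - p) by rewrite opprB addrA subrK.
have [h hE] : exists h, q - p = h by exists (q - p).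
have [k kE] : exists k, z - p = k by exists (z - p).
rewrite hE kE in kh ang.
have hh : 0 < dot h h by rewrite -hE dot_gt0 subr_eq0 eq_sym.
have kk : 0 < dot k k.
  by rewrite dot_gt0; apply/eqP => k0; move: kh; rewrite k0 !dot0l ltxx.
(* [b] is the foot of the perpendicular from the origin to the line through the
   inverses of [h] and [k]. *)
pose D := (dot k k)^-1 *: k - (dot h h)^-1 *: h.
pose N := dot k k - 2 * dot k h + dot h h.
have NE : dot (k - h) (k - h) = N by rewrite /N !dotE (dotC h k); ring.
have N0 : 0 < N.
  rewrite -NE dot_gt0 subr_eq0; apply/eqP => khE.
  by move: kh; rewrite khE ltxx.
have DD : dot D D = N / (dot k k * dot h h).
  by rewrite /D /N !dotE (dotC h k); field; rewrite !gt_eqF.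
have hD : dot h D = (dot k h - dot k k) / dot k k.
  by rewrite /D !dotE (dotC h k); field; rewrite !gt_eqF.
(* This makes [b] orthogonal to [D]; the arc parameters [l] and [l + 1] then give [q] and [z]. *)
pose l := dot h D / dot h h / dot D D.
have DD0 : 0 < dot D D by rewrite DD divr_gt0 // mulr_gt0.
have l0 : 0 < l by rewrite /l !divr_gt0 // hD divr_gt0 // subr_gt0.
have lDD : l * dot D D = dot h D / dot h h by rewrite divfK // gt_eqF.
pose b := (dot h h)^-1 *: h - l *: D.
have cl : b + l *: D = (dot h h)^-1 *: h by rewrite subrK.
have cl1 : b + (l + 1) *: D = (dot k k)^-1 *: k.
  by rewrite scalerDl scale1r addrA cl /D addrC subrK.
have bD : dot b D = 0.
  by rewrite /b dotDl dotNl !dotZl lDD mulrC subrr.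
(* Inversion turns a circle of radius [rho] through the origin into a line at distance
   [1 / (2 rho)], so this is the circumradius bound in [ang]. *)
have b4 : dot b b <= 4^-1.
  have -> : dot b b = (dot k k * dot h h - dot k h ^+ 2) / (dot k k * dot h h * N).
    have -> : dot b b = (dot h h)^-1 - l * (dot h D / dot h h).
      rewrite {1}/b dotDl dotNl !dotZl [dot D b]dotC bD mulr0 subr0.
      rewrite /b dotDr dotNr !dotZr.
      by field; rewrite gt_eqF.
    rewrite /l DD hD /N; field.
    by rewrite !gt_eqF.
  rewrite ler_pdivrMr; last by rewrite !mulr_gt0.
  by move: ang; rewrite NE; lra.
have q0 : 1 - 2 * dot (q - p) (b + l *: D) +
    dot (b + l *: D) (b + l *: D) * dot (q - p) (q - p) = 0.
  by rewrite cl hE !dotE; field; rewrite gt_eqF.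
(* At parameter [l + 1] the function bounded below is [|x - z|^2 / |k|^2]. *)
apply: (arc_proximal_normal S p q b D l (del / dot k k) cS Sq S4 l0 bD b4 q0).
  exact: divr_gt0.
move=> x /Sdel; rewrite zE kE cl1; move: (x - p) => a.
rewrite ler_pdivrMr // !dotE (dotC k a).
have -> : (1 - 2 * ((dot k k)^-1 * dot a k) +
   (dot k k)^-1 * ((dot k k)^-1 * dot k k) * dot a a) * dot k k
   = dot k k - 2 * dot a k + dot a a by field; rewrite gt_eqF.
lra.
Qed.

End Spindles.

(** * The two inclusions *)

Theorem theorem1 (R : realType) (d : nat) (S : set 'rV[R]_d) :
  compact S -> S !=set0 ->
  ker_s S = \bigcap_(x in bd S) conv_s (st_s x S).
Proof.
move=> cS [q0 Sq0]; apply/seteqP; split=> [p [Sp stp] x [Sx _]|p pS].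
  have cl : closed S by apply: compact_closed => //; exact: norm_hausdorff.
  move/cl: Sx => Sx.
  have [_ px] : st_s p S x by rewrite stp.
  move=> C [_]; apply; split=> // z zxp; apply: px; move: zxp.
  by rewrite (spindleC x).
have sub q z : S q -> spindle p q z -> S z.
  move=> Sq pqz; apply: contrapT => Sz.
  have [x [n [K [Sx n1 prox far]]]] := spindle_proximal_normal _ _ _ _ cS Sq pqz Sz.
  exact: (proximal_excludes _ _ _ _ _ Sx n1 prox far pS).
(* [p] is an endpoint of its spindle with [q0]. *)
have Sp : S p by apply: (sub q0 p Sq0); rewrite /spindle; case: ifP => // _ u [].
by split=> //; apply/seteqP; split=> [q []//|q Sq]; split=> // z; exact: sub.
Qed.
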